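(* Let $\mathcal{I}$ be any one of $\mathcal{P}$, $\mathcal{P}_\infty$, $\mathcal{B}$. The isometry class $\{\mu\in\mathcal{I}: X_\mu$ has the DLD2P$\}$ is $G_\delta$-complete in $\mathcal{I}$.
   Context: Coding: $V$ is the set of finitely supported rational sequences; $\mathcal{P}\subset\mathbb{R}^V$ the seminorms on $V$ with pointwise convergence topology; for $\mu\in\mathcal{P}$, $\bar\mu$ is its seminorm extension to $c_{00}$ and $X_\mu$ the completion of $c_{00}/\{\bar\mu=0\}$; $\mathcal{P}_\infty=\{\mu:\dim X_\mu=\infty\}$, $\mathcal{B}=\{\mu\in\mathcal{P}_\infty:\bar\mu$ a norm on $c_{00}\}$, subspace topologies. DLD2P: for every $\varepsilon>0$, every slice $S=\{y\in B_X:f(y)>1-\alpha\}$ ($f\in S_{X^*}$, $\alpha>0$) and every $x\in S\cap S_X$ there is $y\in S$ with $\|x-y\|>2-\varepsilon$. A set $A$ in a Polish space $Z$ is $G_\delta$-complete if it is $G_\delta$ and every $G_\delta$ subset of every zero-dimensional Polish space is a continuous preimage of $A$. *)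

(* Defs.v *)
From HB Require Import structures.
From mathcomp Require Import all_boot all_order all_algebra.
From mathcomp Require Import all_classical all_reals all_analysis.
Set Implicit Arguments. Unset Strict Implicit. Unset Printing Implicit Defensive.
Import Order.TTheory GRing.Theory Num.Theory.
Import numFieldNormedType.Exports.
Local Open Scope classical_set_scope.
Local Open Scope ring_scope.

(* V  = finitely supported rational sequences  = {poly rat}  (coefficients p`_i).
   c00 = finitely supported real sequences      = {poly R}.
   The inclusion V -> c00 is  map_poly ratr. *)
Notation V := {poly rat} (only parsing).
Notation RV R := {ptws {poly rat} -> R^o} (only parsing).

Section Defs.
Variable R : realType.

Local Notation c00 := {poly R} (only parsing).
Definition incl (v : V) : c00 := map_poly (ratr : rat -> R) v.

Local Notation RV := (RV R).

Definition is_seminorm_V (mu : V -> R) : Prop :=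
  (forall v, 0 <= mu v) /\
  (forall v w, mu (v + w) <= mu v + mu w) /\
  (forall (a : rat) v, mu (a *: v) = ratr `|a| * mu v).

Definition is_seminorm_ext (mu : V -> R) (nu : c00 -> R) : Prop :=
  [/\ forall x, 0 <= nu x,
      forall x y, nu (x + y) <= nu x + nu y,
      forall (a : R) x, nu (a *: x) = `|a| * nu x
    & forall v, nu (incl v) = mu v].

(* (X, T) is (a copy of) X_mu: X is a Banach space and T : c00 -> X is linear,
   with ||T x|| = \bar mu (x) and dense range; i.e. T is the quotient map
   c00 -> c00/{\bar mu = 0} followed by the isometric dense embedding into
   the completion.  X_mu is unique up to linear isometry. *)
Definition is_Xmu (mu : V -> R) (X : completeNormedModType R) (T : c00 -> X)
  : Prop :=
  [/\ forall (a : R) x y, T (a *: x + y) = a *: T x + T y,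
      forall nu, is_seminorm_ext mu nu -> forall x, `|T x| = nu x
    & closure (range T) = setT].

Definition infinite_dim (X : normedModType R) : Prop :=
  forall n : nat, exists v : 'I_n -> X,
    forall c : 'I_n -> R, \sum_(i < n) c i *: v i = 0 -> forall i, c i = 0.

Definition unit_dual_functional (X : normedModType R) (f : X -> R) : Prop :=
  [/\ forall (a : R) x y, f (a *: x + y) = a * f x + f y,
      forall y, `|f y| <= `|y|
    & forall d : R, 0 < d -> exists y : X, `|y| <= 1 /\ 1 - d < f y].

Definition DLD2P (X : normedModType R) : Prop :=
  forall (eps : R), 0 < eps ->
  forall (f : X -> R), unit_dual_functional f ->
  forall (alpha : R), 0 < alpha ->
  forall x : X, `|x| <= 1 -> 1 - alpha < f x -> `|x| = 1 ->
    exists y : X, [/\ `|y| <= 1, 1 - alpha < f y & 2 - eps < `|x - y|].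

Definition Pset : set RV := [set mu | is_seminorm_V mu].

Definition Pinf : set RV :=
  [set mu | Pset mu /\
     forall (X : completeNormedModType R) (T : c00 -> X),
       is_Xmu mu T -> infinite_dim X].

Definition Bset : set RV :=
  [set mu | Pinf mu /\
     forall nu, is_seminorm_ext mu nu -> forall x, nu x = 0 -> x = 0].

Definition DLD2Pclass (I : set RV) : set RV :=
  [set mu | I mu /\
     forall (X : completeNormedModType R) (T : c00 -> X),
       is_Xmu mu T -> DLD2P X].

Definition polish (Z : topologicalType) : Prop :=
  (exists D : set Z, countable D /\ closure D = setT) /\
  exists d : Z -> Z -> R,
    [/\ (forall x y, 0 <= d x y) /\ (forall x y, (d x y = 0 <-> x = y)),
        forall x y, d x y = d y x,
        forall x y z, d x z <= d x y + d y z,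
        forall A : set Z, (open A <->
          (forall x, A x -> exists e : R, 0 < e /\ [set y | d x y < e] `<=` A))
      & forall u : nat -> Z,
          (forall e : R, 0 < e -> exists N, forall m n, (N <= m)%N -> (N <= n)%N ->
             d (u m) (u n) < e) ->
          exists l, forall e : R, 0 < e -> exists N, forall n, (N <= n)%N ->
             d (u n) l < e].

Definition clopen_basis (Z : topologicalType) : Prop :=
  forall (U : set Z) (x : Z), open U -> U x ->
    exists W : set Z, [/\ clopen W, W x & W `<=` U].

Definition Gdelta (Z : topologicalType) (A : set Z) : Prop :=
  exists G : nat -> set Z, (forall n, open (G n)) /\ A = \bigcap_n G n.

Definition Gdelta_in (Y : topologicalType) (I A : set Y) : Prop :=
  exists G : nat -> set Y, (forall n, open (G n)) /\ A = I `&` \bigcap_n G n.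

Definition Gdelta_complete (Y : topologicalType) (I A : set Y) : Prop :=
  [/\ A `<=` I, Gdelta_in I A &
    forall (Z : topologicalType), polish Z -> clopen_basis Z ->
    forall C : set Z, Gdelta C ->
      exists f : Z -> Y, [/\ forall z, I (f z), continuous f & C = f @^-1` A]].

End Defs.

(* Main.v *)
Require Import Defs.
From HB Require Import structures.
From mathcomp Require Import all_boot all_order all_algebra.
From mathcomp Require Import all_classical all_reals all_analysis.
From mathcomp Require Import ring lra.
Set Implicit Arguments. Unset Strict Implicit. Unset Printing Implicit Defensive.
Import Order.TTheory GRing.Theory Num.Theory.
Import numFieldNormedType.Exports.
Local Open Scope classical_set_scope.
Local Open Scope ring_scope.

(* By Hahn-Banach separation, X_mu has the DLD2P iff every x in V is, for every
   k, within about 1/k of a rational convex combination of vectors y in V with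
   mu y < mu x + 1/k and mu (x - y) > 2 mu x - 1/k.  For fixed x and k this is
   an open condition on mu, hence the class is G_delta.

   For hardness, view V as the rational polynomials and let mu be the sup norm
   over an infinite subset K of [0, 1], so that X_mu = C(closure K) and the
   DLD2P says that K has no isolated point.  Given C = bigcap_n G_n in
   Z, let t_n z be the truncated distance from z to the complement of G_n and K
   the union over n of the intervals [2^-n (1 - t_n z / 4), 2^-n]: the point
   2^-n is isolated in K iff t_n z = 0, i.e. iff z is not in G_n.  Explicit
   peak polynomials (1 - (X - q)^2)^m replace the Weierstrass theorem. *)

(* Unqualified, [incl] is the inclusion map of mathcomp.classical.functions. *)
Local Notation incl := Defs.incl.

(** * Hahn-Banach separation for rational vector spaces *)

Section Sublinear.
Variables (R : realType) (E : lmodType rat).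
Implicit Types (p q : E -> R) (a b : rat).

Definition sublinear p :=
  (forall x y, p (x + y) <= p x + p y) /\
  (forall a x, 0 < a -> p (a *: x) <= ratr a * p x).

Definition Qlinear (f : E -> R) :=
  forall a x y, f (a *: x + y) = ratr a * f x + f y.

Lemma Qlinear0 f : Qlinear f -> f 0 = 0.
Proof.
by move=> fL; have := fL 1 0 0; rewrite scaler0 addr0 rmorph1 mul1r => h; lra.
Qed.

Lemma QlinearZ f a x : Qlinear f -> f (a *: x) = ratr a * f x.
Proof.
by move=> fL; rewrite -[a *: x]addr0 fL Qlinear0// addr0.
Qed.

Lemma QlinearN f x : Qlinear f -> f (- x) = - f x.
Proof. by move=> fL; rewrite -scaleN1r QlinearZ// rmorphN1 mulN1r. Qed.

Lemma QlinearB f x y : Qlinear f -> f (x - y) = f x - f y.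
Proof. by move=> fL; rewrite -[x]scale1r fL rmorph1 mul1r scale1r QlinearN. Qed.

Lemma sublinear0 p : sublinear p -> p 0 = 0.
Proof.
move=> [pD pZ].
have := pD 0 0; rewrite addr0 => h1.
have := pZ 2^-1 0; rewrite scaler0 fmorphV rmorph_nat => /(_ isT) h2.
lra.
Qed.

Lemma sublinearZ p a x : sublinear p -> 0 <= a -> p (a *: x) = ratr a * p x.
Proof.
move=> sp; rewrite le_eqVlt => /predU1P[<-|a0].
  by rewrite scale0r rmorph0 mul0r sublinear0.
case: sp => pD pZ; apply/eqP; rewrite eq_le pZ//=.
have := pZ a^-1 (a *: x).
rewrite scalerA mulVf ?gt_eqF// scale1r invr_gt0 => /(_ a0).
by rewrite fmorphV ler_pdivlMl ?ltr0q.
Qed.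

Lemma sublinear_ge p x : sublinear p -> - p (- x) <= p x.
Proof.
by move=> sp; rewrite lerNl -subr_ge0 opprK -(sublinear0 sp) -(addNr x); case: sp.
Qed.

(** Serves three infima: over a rational parameter, over a chain, and over lists of weighted
    vectors. The index [k] covers adding parameters, comparing in a chain and concatenating
    lists. *)
Lemma sublinear_inf (J : Type) (A : set J) (F : J -> E -> R) :
  A !=set0 ->
  (forall z, has_lbound [set F j z | j in A]) ->
  (forall i j x y, A i -> A j ->
     exists2 k, A k & F k (x + y) <= F i x + F j y) ->
  (forall i a x, A i -> 0 < a ->
     exists2 k, A k & F k (a *: x) <= ratr a * F i x) ->
  sublinear (fun z => inf [set F j z | j in A]).
Proof.
move=> [i0 Ai0] lbF FD FZ; split => [x y|a x a0].
- rewrite -lerBlDr; apply: lb_le_inf; first by exists (F i0 x), i0.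
  move=> _ [i Ai <-]; rewrite lerBlDr -lerBlDl.
  apply: lb_le_inf; first by exists (F i0 y), i0.
  move=> _ [j Aj <-]; rewrite lerBlDl.
  have [k Ak] := FD i j x y Ai Aj; apply: le_trans.
  by apply: ge_inf => //; exists k.
- rewrite -ler_pdivrMl ?ltr0q//; apply: lb_le_inf; first by exists (F i0 x), i0.
  move=> _ [i Ai <-]; rewrite ler_pdivrMl ?ltr0q//.
  have [k Ak] := FZ i a x Ai a0; apply: le_trans.
  by apply: ge_inf => //; exists k.
Qed.

(* The infimum over [t >= 0] of [q (z + t y) - t q y] is sublinear and below
   [q], hence equal to [q] by minimality; evaluate it at [z = - y], [t = 1]. *)
Lemma minimal_sublinear_odd q :
  sublinear q ->
  (forall q', sublinear q' -> (forall x, q' x <= q x) ->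
     forall x, q x <= q' x) ->
  forall y, q (- y) = - q y.
Proof.
move=> sq qmin y; have [qD qZ] := sq.
pose F (t : rat) z := q (z + t *: y) - ratr t * q y.
have lbF z : has_lbound [set F t z | t in [set t | 0 <= t]].
  exists (- q (- z)) => _ [t /= t0 <-]; rewrite /F -(sublinearZ _ sq t0).
  have := qD (z + t *: y) (- z); rewrite [_ + _ + - z]addrC addKr; lra.
pose q' z := inf [set F t z | t in [set t | 0 <= t]].
have q'le z t : 0 <= t -> q' z <= F t z.
  by move=> t0; apply: ge_inf => //; exists t.
have sq' : sublinear q'.
  apply: sublinear_inf => //; first by exists 0 => /=.
  - move=> s t x z /= s0 t0; exists (s + t); first exact: addr_ge0.
    rewrite /F scalerDl addrACA rmorphD mulrDl /=.
    by have := qD (x + s *: y) (z + t *: y); lra.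
  - move=> s a x /= s0 a0; exists (a * s); first by rewrite mulr_ge0 // ltW.
    rewrite /F -scalerA -scalerDr rmorphM /=.
    by have := qZ a (x + s *: y) a0; lra.
have q'q x : q' x <= q x.
  apply: le_trans (q'le x 0 _) _; rewrite // /F.
  by rewrite scale0r addr0 rmorph0 mul0r subr0.
have := qmin _ sq' q'q (- y); have := q'le (- y) 1 ler01.
rewrite /F scale1r addNr sublinear0// rmorph1 mul1r.
by have := sublinear_ge y sq; lra.
Qed.

(** Zorn's lemma yields a minimal sublinear functional below [p]; minimality makes it odd, and an
    odd sublinear functional is linear. *)
Lemma sublinear_dominates_linear p : sublinear p ->
  exists f : E -> R, Qlinear f /\ forall x, f x <= p x.
Proof.
move=> sp.
pose T := {q : E -> R | sublinear q /\ forall x, q x <= p x}.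
(* The order is reversed: a maximal element for [Rl] is a minimal functional, and a chain is bounded
   by its pointwise infimum. *)
pose Rl (q1 q2 : T) := `[< forall x, sval q2 x <= sval q1 x >].
have [|||A Atot|[q [sq qp]] qmax] := @Zorn T Rl.
- by move=> q; apply/asboolP.
- move=> q1 q2 q3 /asboolP h1 /asboolP h2; apply/asboolP => x.
  exact: le_trans (h2 x) (h1 x).
- move=> [q1 h1] [q2 h2] /asboolP /= h /asboolP /= h'; apply: eq_exist => /=.
  by apply/funext => x; apply/eqP; rewrite eq_le h h'.
(* The empty chain is bounded by [p]; an infimum over it would be a mere default value. *)
- have [->|/set0P A0] := eqVneq A set0.
    by exists (exist _ p (conj sp (fun x => lexx _))).
  pose q z := inf [set sval r z | r in A].
  have lbA z : has_lbound [set sval (r : T) z | r in A].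
    exists (- p (- z)) => _ [[r [sr rp]] /= _ <-].
    by apply: le_trans (sublinear_ge z sr); rewrite lerN2.
  have qle (r : T) z : A r -> q z <= sval r z.
    by move=> Ar; apply: ge_inf => //; exists r.
  have sq : sublinear q.
    apply: sublinear_inf => //.
    + move=> i j x y Ai Aj.
      have [/asboolP ij|/asboolP ji] := Atot _ _ Ai Aj.
      * exists j => //; have := (proj1 (proj1 (proj2_sig j))) x y.
        by have := ij x; lra.
      * exists i => //; have := (proj1 (proj1 (proj2_sig i))) x y.
        by have := ji y; lra.
    + move=> i a x Ai a0; exists i => //.
      exact: (proj2 (proj1 (proj2_sig i))).
  have qp z : q z <= p z.
    have [r Ar] := A0; apply: le_trans (qle r z Ar) _.
    exact: (proj2 (proj2_sig r)).
  by exists (exist _ q (conj sq qp)) => r Ar; apply/asboolP => x; exact: qle.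
exists q; split => //.
have qodd : forall y, q (- y) = - q y.
  apply: minimal_sublinear_odd => // q' sq' q'q x.
  have q'p z : q' z <= p z by apply: le_trans (q'q z) _.
  have := qmax (exist _ q' (conj sq' q'p)) => /=.
  by move=> /(_ ltac:(by apply/asboolP)) [->].
have qZ a x : q (a *: x) = ratr a * q x.
  have [a0|a0] := leP 0 a; first exact: sublinearZ.
  rewrite -[a in LHS]opprK scaleNr qodd sublinearZ ?rmorphN ?mulNr ?opprK//.
  by rewrite oppr_ge0 ltW.
have [qD _] := sq.
move=> a x y; rewrite -qZ; apply/eqP; rewrite eq_le qD /=.
have := qD (- (a *: x)) (- y); rewrite -opprD !qodd; lra.
Qed.

Definition is_Qseminorm (mu : E -> R) :=
  (forall x y, mu (x + y) <= mu x + mu y) /\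
  (forall a x, mu (a *: x) = ratr `|a| * mu x).

Lemma QseminormN mu x : is_Qseminorm mu -> mu (- x) = mu x.
Proof. by case=> _ muZ; rewrite -scaleN1r muZ normrN normr1 rmorph1 mul1r. Qed.

Lemma Qseminorm0 mu : is_Qseminorm mu -> mu 0 = 0.
Proof. by case=> _ muZ; rewrite -(scale0r 0) muZ normr0 rmorph0 mul0r. Qed.

(* The functional
   [p z = inf {mu (z - sum l_j w_j) - d sum l_j | l_j >= 0, w_j in G}] is
   sublinear, dominated by [mu] (empty sum) and at most [- d] on [G]. *)
Lemma seminorm_separation (mu : E -> R) (G : set E) (d : R) :
  is_Qseminorm mu ->
  (forall l : seq (rat * E), (forall j, j \in l -> 0 <= j.1 /\ G j.2) ->
     d * ratr (\sum_(j <- l) j.1) <= mu (\sum_(j <- l) j.1 *: j.2)) ->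
  exists f : E -> R, [/\ Qlinear f, forall x, `|f x| <= mu x
    & forall w, G w -> f w <= - d].
Proof.
move=> smu dG; have [muD muZ] := smu.
have muN x : mu (- x) = mu x by exact: QseminormN.
pose F (l : seq (rat * E)) z :=
  mu (z - \sum_(j <- l) j.1 *: j.2) - d * ratr (\sum_(j <- l) j.1).
pose A := [set l : seq (rat * E) | forall j, j \in l -> 0 <= j.1 /\ G j.2].
pose p z := inf [set F l z | l in A].
have A0 : A [::] by [].
have F0 z : F [::] z = mu z by rewrite /F !big_nil subr0 rmorph0 mulr0 subr0.
have lbF z : has_lbound [set F l z | l in A].
  exists (- mu z) => _ [l Al <-]; rewrite /F.
  set w := \sum_(j <- l) _.
  have := muD (z - w) (- z); rewrite [_ + _ + - z]addrC addKr !muN.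
  by have := dG l Al; rewrite -/w; lra.
have ple z l : A l -> p z <= F l z by move=> Al; apply: ge_inf => //; exists l.
have sp : sublinear p.
  apply: sublinear_inf => //; first by exists [::].
  - move=> l m x y Al Am; exists (l ++ m).
      by move=> j; rewrite mem_cat => /orP[/Al|/Am].
    rewrite /F !big_cat /= opprD addrACA rmorphD mulrDr /=.
    have := muD (x - \sum_(j <- l) j.1 *: j.2) (y - \sum_(j <- m) j.1 *: j.2).
    by lra.
  - move=> l a x Al a0; exists [seq (a * j.1, j.2) | j <- l].
      by move=> _ /mapP[j /Al [j0 Gj] ->] /=; rewrite mulr_ge0// ltW.
    rewrite /F !big_map /= -mulr_sumr rmorphM /=.
    under eq_bigr do rewrite -scalerA.
    by rewrite -scaler_sumr -scalerBr muZ gtr0_norm// mulrBr mulrCA.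
have [f [fL fp]] := sublinear_dominates_linear sp.
have fle x : f x <= mu x.
  by apply: le_trans (fp x) _; apply: le_trans (ple x _ A0) _; rewrite F0.
exists f; split => // [x|w Gw].
  by rewrite ler_norml fle -[mu x]muN lerNl -QlinearN// fle.
apply: le_trans (fp w) _; apply: le_trans (ple w [:: (1, w)] _) _.
  by move=> j; rewrite inE => /eqP ->.
by rewrite /F !big_seq1 scale1r subrr Qseminorm0// rmorph1 mulr1 sub0r.
Qed.

(** Separation from the single vector [- x]; its hypothesis holds with equality because [mu] is
    homogeneous. *)
Lemma seminorm_attained (mu : E -> R) x : is_Qseminorm mu ->
  exists f : E -> R, [/\ Qlinear f, forall y, `|f y| <= mu y & f x = mu x].
Proof.
move=> smu; have [muD muZ] := smu.
have [l hl|f [fL fmu fx]] := @seminorm_separation mu [set - x] (mu x) smu.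
  have -> : \sum_(j <- l) j.1 *: j.2 = (\sum_(j <- l) j.1) *: - x.
    by rewrite scaler_suml; apply: eq_big_seq => j /hl[_ ->].
  rewrite muZ QseminormN// ger0_norm 1?mulrC//.
  by rewrite big_seq; apply: sumr_ge0 => j /hl[].
exists f; split => //; apply/eqP; rewrite eq_le (le_trans (ler_norm _) (fmu x)) /=.
by have := fx (- x) erefl; rewrite QlinearN// lerN2.
Qed.

End Sublinear.

(** * Completion of a seminormed rational vector space *)

Lemma ratr_approx (R : realType) (a e : R) :
  0 < e -> exists q : rat, `|a - ratr q| <= e.
Proof.
move=> e0; have [|q] := @rat_in_itvoo R a (a + e); first by rewrite ltrDl.
rewrite in_itv /= => /andP[h1 h2]; exists q.
by rewrite distrC ger0_norm; lra.
Qed.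

Section Completion.
Variables (R : realType) (E : lmodType rat) (mu : E -> R).

Definition dominated :=
  {f : E -> R | Qlinear f /\ forall x, `|f x| <= mu x}.
Local Notation S := dominated.

(** Uniform limits, on the dual unit ball, of evaluations at vectors of [E]. For a seminorm [mu]
    they form the completion of [E], with the kernel of [mu] quotiented out at the same time. *)
Definition approximable : {pred (S -> R)} :=
  fun phi => `[< forall e, 0 < e ->
    exists x, forall f : S, `|phi f - sval f x| <= e >].

(** Real scalars are reached from rational ones: replacing [a] by a nearby rational [q] costs at
    most [|a - q| mu x], uniformly over the dominated functionals. *)
Lemma approximable_submod : submod_closed approximable.
Proof.
split=> [|a phi psi].
  apply/asboolP => e e0; exists 0 => f.
  by rewrite Qlinear0 ?subrr ?normr0 ?ltW//; case: (proj2_sig f).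
move=> /asboolP hphi /asboolP hpsi; apply/asboolP => e e0.
have a1 : 0 < `|a| + 1 by have := normr_ge0 a; lra.
have [|x hx] := hphi (e / 3 / (`|a| + 1)); first by rewrite !divr_gt0.
have [|y hy] := hpsi (e / 3); first by rewrite divr_gt0.
have m1 : 0 < `|mu x| + 1 by have := normr_ge0 (mu x); lra.
have [|q hq] := ratr_approx a (e := e / 3 / (`|mu x| + 1)).
  by rewrite !divr_gt0.
exists (q *: x + y) => f; rewrite (proj1 (proj2_sig f)).
have -> : (a *: phi + psi) f - (ratr q * sval f x + sval f y) =
    a * (phi f - sval f x) + (psi f - sval f y) + (a - ratr q) * sval f x.
  rewrite -[(a *: phi + psi) f]/(a * phi f + psi f); ring.
apply: le_trans (ler_normD _ _) _.
apply: le_trans (lerD (ler_normD _ _) (lexx _)) _; rewrite !normrM.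
have := hy f.
have : `|a| * `|phi f - sval f x| <= e / 3.
  apply: le_trans (_ : (`|a| + 1) * `|phi f - sval f x| <= _).
    by apply: ler_wpM2r => //; lra.
  by rewrite mulrC -ler_pdivlMr.
have : `|a - ratr q| * `|sval f x| <= e / 3.
  apply: le_trans (_ : `|a - ratr q| * (`|mu x| + 1) <= _).
    apply: ler_wpM2l => //; have := (proj2 (proj2_sig f)) x.
    by have := ler_norm (mu x); lra.
  by rewrite -ler_pdivlMr.
lra.
Qed.

HB.instance Definition _ :=
  GRing.isSubmodClosed.Build R (S -> R) approximable approximable_submod.

Record completion := Completion {
  completion_val : S -> R;
  _ : completion_val \in approximable }.

HB.instance Definition _ := [isSub for completion_val].
HB.instance Definition _ := [Choice of completion by <:].
HB.instance Definition _ := [SubChoice_isSubLmodule of completion by <:].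

Implicit Types phi psi : completion.

(** The sup norm on the dual ball. The value 0 keeps the set nonempty even when [mu] dominates no
    functional. *)
Definition completion_norm phi : R :=
  sup [set r | r = 0 \/ exists f : S, r = `|\val phi f| ].

Lemma completion_norm_nonempty phi :
  [set r | r = 0 \/ exists f : S, r = `|\val phi f| ] !=set0.
Proof. by exists 0; left. Qed.

Lemma completion_norm_has_ubound phi :
  has_ubound [set r | r = 0 \/ exists f : S, r = `|\val phi f| ].
Proof.
have [|x hx] := (asboolP _ (valP phi)) 1; first by [].
exists (`|mu x| + 1) => r [->|[f ->]]; first by have := normr_ge0 (mu x); lra.
have := hx f; have := (proj2 (proj2_sig f)) x; have := ler_norm (mu x).
have := ler_normD (\val phi f - sval f x) (sval f x); rewrite subrK.
by move=> /=; lra.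
Qed.

Lemma le_completion_norm phi f : `|\val phi f| <= completion_norm phi.
Proof.
apply: ub_le_sup; first exact: completion_norm_has_ubound.
by right; exists f.
Qed.

Lemma completion_norm_ge0 phi : 0 <= completion_norm phi.
Proof.
by apply: ub_le_sup; [exact: completion_norm_has_ubound|left].
Qed.

Lemma completion_norm_le phi c :
  0 <= c -> (forall f, `|\val phi f| <= c) -> completion_norm phi <= c.
Proof.
move=> c0 hc; apply: ge_sup; first exact: completion_norm_nonempty.
by move=> r [->|[f ->]].
Qed.

Lemma completion_normD phi psi :
  completion_norm (phi + psi) <= completion_norm phi + completion_norm psi.
Proof.
apply: completion_norm_le => [|f]; first by rewrite addr_ge0 ?completion_norm_ge0.
apply: le_trans (ler_normD _ _) _; exact: lerD (le_completion_norm _ _) (le_completion_norm _ _).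
Qed.

Lemma completion_normZ (a : R) phi :
  completion_norm (a *: phi) = `|a| * completion_norm phi.
Proof.
have le b psi : completion_norm (b *: psi) <= `|b| * completion_norm psi.
  apply: completion_norm_le => [|f]; first by rewrite mulr_ge0 ?completion_norm_ge0.
  by rewrite -[\val (b *: psi) f]/(b * \val psi f) normrM ler_wpM2l ?le_completion_norm.
apply/eqP; rewrite eq_le le /=.
have [->|a0] := eqVneq a 0; first by rewrite normr0 mul0r completion_norm_ge0.
have := le a^-1 (a *: phi); rewrite scalerA mulVf// scale1r normfV.
by rewrite ler_pdivlMl ?normr_gt0.
Qed.

Lemma completion_norm0_eq0 phi : completion_norm phi = 0 -> phi = 0.
Proof.
move=> phi0; apply/val_inj/funext => f; apply/eqP; rewrite -normr_le0 -phi0.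
exact: le_completion_norm.
Qed.

HB.instance Definition _ := Lmodule_isNormed.Build R completion
  completion_normD completion_normZ completion_norm0_eq0.

(** Pointwise limits exist by completeness of the reals; the Cauchy condition makes the convergence
    uniform in [f], and a uniform limit of approximable functions is approximable. *)
Lemma completion_complete (F : set_system completion) :
  ProperFilter F -> cauchy F -> cvg F.
Proof.
move=> FF /cauchyP Fc.
have ballE phi e psi : ball phi e psi -> completion_norm (phi - psi) < e.
  by rewrite -ball_normE.
have evc (f : S) : cvg ((fun phi => \val phi f) @ F).
  apply: R_complete; apply/cauchyP => e e0; have [phi Fphi] := Fc e e0.
  exists (\val phi f).
  have : F [set psi : completion | ball (\val phi f) e (\val psi f)].
    apply: filterS Fphi => psi /ballE.
    rewrite -ball_normE /=; apply: le_lt_trans.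
    exact: (le_completion_norm (phi - psi) f).
  exact.
pose lm f := lim ((fun phi => \val phi f) @ F).
have near_lm e phi : 0 < e -> F (ball phi e) -> forall f, `|lm f - \val phi f| <= e.
  move=> e0 Fphi f; apply/ler_addgt0Pr => d d0.
  have /cvgrPdist_le /(_ d d0) Fd := evc f.
  have [psi [/ballE h1 h2]] := filter_ex (filterI Fphi Fd).
  have h3 : `|\val psi f - \val phi f| <= completion_norm (phi - psi).
    rewrite distrC; exact: (le_completion_norm (phi - psi) f).
  have := ler_normD (lm f - \val psi f) (\val psi f - \val phi f).
  rewrite addrA subrK; move: h2 h3; rewrite -/(lm f) /= => h2 h3; lra.
have lm_approx : lm \in approximable.
  apply/asboolP => e e0.
  have [|phi Fphi] := Fc (e / 2); first by rewrite divr_gt0.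
  have [|x hx] := (asboolP _ (valP phi)) (e / 2); first by rewrite divr_gt0.
  exists x => f; have := hx f; have := near_lm (e / 2) phi _ Fphi f.
  have := ler_normD (lm f - \val phi f) (\val phi f - sval f x).
  rewrite addrA subrK => h1 /(_ ltac:(lra)) h2 h3; move: h3 => /= h3; lra.
apply/cvg_ex; exists (Completion lm_approx); apply/cvgrPdist_le => e e0.
have e20 : 0 < e / 2 by rewrite divr_gt0.
have [phi Fphi] := Fc _ e20.
have hphi : `|Completion lm_approx - phi| <= e / 2.
  by apply: completion_norm_le => [|f]; [lra|exact: near_lm].
apply: filterS Fphi => psi; rewrite -ball_normE => /= h.
have := ler_normD (Completion lm_approx - phi) (phi - psi).
rewrite addrA subrK; lra.
Qed.

HB.instance Definition _ := Uniform_isComplete.Build completion completion_complete.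

End Completion.

(** * The space X_mu *)

Section EvalCompletion.
Variables (R : realType) (E : lmodType rat) (mu : E -> R).

Lemma eval_approximable (v : E) :
  (fun f : dominated mu => sval f v) \in @approximable R E mu.
Proof. by apply/asboolP => e e0; exists v => f; rewrite subrr normr0 ltW. Qed.

Definition eval_completion v : completion mu :=
  Completion (eval_approximable v).

Lemma completion_sumE n (c : 'I_n -> R) (phi : 'I_n -> completion mu) f :
  \val (\sum_(i < n) c i *: phi i) f = \sum_(i < n) c i * \val (phi i) f.
Proof. exact: (big_morph (fun psi : completion mu => \val psi f)). Qed.

Lemma norm_eval_completion v : is_Qseminorm mu -> `|eval_completion v| = mu v.
Proof.
move=> smu; rewrite -[LHS]/(completion_norm _).
have [f [fL fmu fv]] := seminorm_attained v smu.
have mu0 : 0 <= mu v by apply: le_trans (fmu v).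
apply/eqP; rewrite eq_le; apply/andP; split.
  by apply: completion_norm_le => // g; exact: (proj2 (proj2_sig g)).
have := le_completion_norm (eval_completion v) (exist _ f (conj fL fmu)).
by rewrite /= fv ger0_norm.
Qed.

Lemma eval_completion_near (phi : completion mu) e :
  0 < e -> exists v, `|phi - eval_completion v| <= e.
Proof.
move=> e0; have [v hv] := asboolP _ (valP phi) _ e0.
by exists v; apply: completion_norm_le => //; exact: ltW.
Qed.

End EvalCompletion.

Section Xmu.
Variable R : realType.
Implicit Types (mu : {poly rat} -> R) (v w : {poly rat}).

Lemma seminorm_V_Qseminorm mu : is_seminorm_V mu -> is_Qseminorm mu.
Proof. by case=> _ []. Qed.

Lemma inclD v w : incl R (v + w) = incl R v + incl R w.
Proof. exact: rmorphD. Qed.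

Lemma inclB v w : incl R (v - w) = incl R v - incl R w.
Proof. exact: rmorphB. Qed.

Lemma inclZ a v : incl R (a *: v) = ratr a *: incl R v.
Proof. exact: map_polyZ. Qed.

(** Coefficients are rounded one at a time, by induction on the number of monomials, with a
    precision adapted to [nu 'X^n]. *)
Lemma poly_seminorm_dense (nu : {poly R} -> R) :
  (forall x y, nu (x + y) <= nu x + nu y) ->
  (forall (a : R) x, nu (a *: x) = `|a| * nu x) ->
  forall x e, 0 < e -> exists v, nu (x - incl R v) <= e.
Proof.
move=> nuD nuZ x; rewrite -[x]coefK poly_def.
elim: (size x) => [|n IH] e e0.
  exists 0; rewrite big_ord0 /incl rmorph0 subr0 -(scale0r 0) nuZ normr0 mul0r.
  exact: ltW.
have [|v hv] := IH (e / 2); first by rewrite divr_gt0.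
have n1 : 0 < `|nu 'X^n| + 1 by have := normr_ge0 (nu 'X^n); lra.
have [|q hq] := ratr_approx x`_n (e := e / 2 / (`|nu 'X^n| + 1)).
  by rewrite !divr_gt0.
exists (v + q *: 'X^n).
rewrite big_ord_recr /= inclD inclZ /incl map_polyXn opprD addrACA -scalerBl.
apply: le_trans (nuD _ _) _; rewrite nuZ.
have : `|x`_n - ratr q| * nu 'X^n <= e / 2.
  apply: le_trans (_ : `|x`_n - ratr q| * (`|nu 'X^n| + 1) <= _).
    by apply: ler_wpM2l => //; have := ler_norm (nu 'X^n); lra.
  by rewrite -ler_pdivlMr.
move: hv; rewrite /incl; lra.
Qed.

Lemma seminorm_ext_unique mu nu1 nu2 :
  is_seminorm_ext mu nu1 -> is_seminorm_ext mu nu2 -> nu1 =1 nu2.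
Proof.
move=> h1 h2.
suff le nu nu' : is_seminorm_ext mu nu -> is_seminorm_ext mu nu' ->
    forall x, nu x <= nu' x.
  by move=> x; apply/eqP; rewrite eq_le !le.
move=> {nu1 nu2 h1 h2} [nu0 nuD nuZ nuv] [nu'0 nu'D nu'Z nu'v] x.
apply/ler_addgt0Pr => e e0.
(* Density for the sum of the two seminorms gives one [v] close to [x] for both. *)
have [||v hv] := @poly_seminorm_dense (fun x => nu x + nu' x) _ _ x e e0.
- by move=> y z; have := nuD y z; have := nu'D y z; lra.
- by move=> a y; rewrite nuZ nu'Z mulrDr.
have := nuD (x - incl R v) (incl R v); rewrite subrK nuv -nu'v.
have := nu'D (- (x - incl R v)) x; rewrite opprB subrK.
rewrite -opprB -scaleN1r nu'Z normrN normr1 mul1r; lra.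
Qed.

Lemma sum_coef_widen (W : lmodType R) (w : nat -> W) (x : {poly R}) n :
  (size x <= n)%N ->
  \sum_(i < size x) x`_i *: w i = \sum_(i < n) x`_i *: w i.
Proof.
move=> xn; rewrite (big_ord_widen n (fun i => x`_i *: w i))// big_mkcond /=.
by apply: eq_bigr => i _; case: ltnP => // hi; rewrite nth_default ?scale0r.
Qed.

Section Quotient.
Variables (mu : {poly rat} -> R) (smu : is_seminorm_V mu).

Definition to_completion (x : {poly R}) : completion mu :=
  \sum_(i < size x) x`_i *: eval_completion mu 'X^i.

Lemma to_completion_linear (a : R) x y :
  to_completion (a *: x + y) = a *: to_completion x + to_completion y.
Proof.
rewrite /to_completion.
pose n := maxn (size (a *: x + y)) (maxn (size x) (size y)).
rewrite !(@sum_coef_widen _ (fun i => eval_completion mu 'X^i) _ n) ?leq_max ?leqnn ?orbT//.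
rewrite scaler_sumr -big_split /=; apply: eq_bigr => i _.
by rewrite coefD coefZ scalerDl scalerA.
Qed.

Lemma to_completion_incl v : to_completion (incl R v) = eval_completion mu v.
Proof.
apply/val_inj/funext => f; rewrite /to_completion completion_sumE /=.
rewrite size_map_poly; have fL := proj1 (proj2_sig f).
rewrite -[in RHS](coefK v) poly_def.
rewrite (big_morph (sval f) (id1 := 0) (op1 := +%R)); first last.
- exact: Qlinear0.
- by move=> x y; have := fL 1 x y; rewrite scale1r rmorph1 mul1r.
by apply: eq_bigr => i _; rewrite coef_map QlinearZ.
Qed.

(** Existence of the extension; with uniqueness, it identifies the [nu] over which [is_Xmu]
    quantifies. *)
Lemma norm_to_completion_ext :
  is_seminorm_ext mu (fun x => `|to_completion x|).
Proof.
have T0 : to_completion 0 = 0 by rewrite /to_completion size_poly0 big_ord0.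
split => // [x y|a x|v].
- rewrite -[x]scale1r to_completion_linear !scale1r; exact: ler_normD.
- by rewrite -[a *: x]addr0 to_completion_linear T0 addr0 normrZ.
- by rewrite to_completion_incl norm_eval_completion//; exact: seminorm_V_Qseminorm.
Qed.

Lemma to_completion_is_Xmu : is_Xmu mu to_completion.
Proof.
split; first exact: to_completion_linear.
- by move=> nu hnu x; apply: seminorm_ext_unique norm_to_completion_ext hnu x.
- apply/seteqP; split=> // phi _ B /nbhs_ballP[e /= e0 eB].
  have [|v hv] := @eval_completion_near _ _ mu phi (e / 2); first by rewrite divr_gt0.
  exists (eval_completion mu v); split.
    by exists (incl R v) => //; exact: to_completion_incl.
  by apply: eB; rewrite -ball_normE /=; lra.
Qed.

End Quotient.
End Xmu.

(** * The DLD2P as a condition on the seminorm *)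

Section Diametral.
Variable R : realType.
Implicit Types (mu : {poly rat} -> R) (v w x y : {poly rat}).

Definition almost_diametral mu x (k : nat) y :=
  mu y < mu x + k.+1%:R^-1 /\ 2 * mu x - k.+1%:R^-1 < mu (x - y).

(* [x] is, up to [1/(k+1)], a rational convex combination of vectors that are
   almost diametral to it; unlike membership in a slice, this is an open
   condition on [mu]. *)
Definition diametral_hull mu x (k : nat) :=
  exists l : seq (rat * {poly rat}),
    (forall j, j \in l -> 0 <= j.1 /\ almost_diametral mu x k j.2) /\
    mu (\sum_(j <- l) j.1 *: (j.2 - x)) < k.+1%:R^-1 * ratr (\sum_(j <- l) j.1).

Lemma Qlinear_sum (h : {poly rat} -> R) (l : seq (rat * {poly rat})) g :
  Qlinear h ->
  h (\sum_(j <- l) j.1 *: g j) = \sum_(j <- l) ratr j.1 * h (g j).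
Proof.
move=> hL; rewrite (big_morph h (id1 := 0) (op1 := +%R)).
- by apply: eq_bigr => j _; rewrite QlinearZ.
- by move=> x y; have := hL 1 x y; rewrite scale1r rmorph1 mul1r.
- exact: Qlinear0.
Qed.

(** A rational [v] near [x] is nearly an average of almost diametral vectors, so [f] cannot drop by
    much at all of them; one at which it does not, scaled into the unit ball, is the required
    [y]. *)
Lemma diametral_hull_DLD2P mu (X : completeNormedModType R) (T : {poly R} -> X) :
  is_seminorm_V mu -> is_Xmu mu T ->
  (forall x k, diametral_hull mu x k) -> DLD2P X.
Proof.
move=> smu [TL normT clT] hull eps eps0 f [fL fle _] alpha alpha0 x _ fx nx.
have nTv v : `|T (incl R v)| = mu v.
  rewrite (normT _ (norm_to_completion_ext smu)).
  by case: (norm_to_completion_ext smu).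
have f0 : f 0 = 0.
  by have := fL 1 0 0; rewrite scaler0 addr0 mul1r => h; lra.
have fB a b : f (a - b) = f a - f b.
  by rewrite addrC -scaleN1r fL mulN1r addrC.
have TB v w : T (incl R (v - w)) = T (incl R v) - T (incl R w).
  rewrite inclB -[X in X - _]scale1r -scaleN1r addrC.
  by rewrite TL scaleN1r scale1r addrC.
pose h v := f (T (incl R v)).
have hL : Qlinear h by move=> a v w; rewrite /h inclD inclZ TL fL.
have hmu v : `|h v| <= mu v by rewrite -nTv; exact: fle.
pose eta := f x - (1 - alpha).
have eta0 : 0 < eta by rewrite subr_gt0.
(* The value of [f] will lose at most [4 * d] and the distance [6 * d]; the extra [d] makes both
   inequalities strict. *)
have [d [d0 d1 d2]] : exists d : R, [/\ 0 < d, 5 * d <= eta & 7 * d <= eps].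
  have [le|le] := leP (5^-1 * eta) (7^-1 * eps).
    by exists (5^-1 * eta); split; lra.
  by exists (7^-1 * eps); split; lra.
have [v hv] : exists v, `|x - T (incl R v)| <= d.
  have : closure (range T) x by rewrite clT.
  move=> /(_ (ball x (d / 2))) [|_ [[z _ <-] hz]].
    by apply: nbhsx_ballx; rewrite divr_gt0.
  have [|||v hv] := @poly_seminorm_dense R (fun z => `|T z|) _ _ z (d / 2).
  - move=> a b /=; rewrite -[a]scale1r TL !scale1r; exact: ler_normD.
  - move=> a b /=; have T0 : T 0 = 0.
      by have := TL (-1) 0 0; rewrite !scaleN1r addr0 oppr0 addNr.
    by rewrite -[a *: b]addr0 TL T0 addr0 normrZ.
  - by rewrite divr_gt0.
  exists v; have := ler_normD (x - T z) (T z - T (incl R v)).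
  rewrite addrA subrK; move: hz; rewrite -ball_normE /=.
  move: hv => /=; have -> : z - incl R v = (-1) *: incl R v + z.
    by rewrite scaleN1r addrC.
  by rewrite TL scaleN1r [_ + T z]addrC; lra.
pose k := Num.trunc d^-1.
have kd : k.+1%:R^-1 <= d.
  rewrite -[d]invrK lef_pV2 ?posrE ?invr_gt0 ?ltr0n//.
  by apply: ltW; rewrite /k; exact: truncnS_gt.
have kp : 0 < k.+1%:R^-1 :> R by rewrite invr_gt0 ltr0n.
have [l [hl hsum]] := hull v k.
(* If [h] dropped by at least [1/(k+1)] at every [j], the sum in [hsum] would contradict the bound
   of [h] by [mu]. *)
have [j jl hj] : exists2 j, j \in l & - k.+1%:R^-1 < h j.2 - h v.
  apply: contrapT => hno.
  have := hmu (\sum_(j <- l) j.1 *: (j.2 - v)).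
  rewrite Qlinear_sum// ler_norml => /andP[+ _].
  apply/negP; rewrite -ltNge.
  apply: le_lt_trans (_ : - (k.+1%:R^-1 * ratr (\sum_(j <- l) j.1)) < _); last first.
    by rewrite ltrN2.
  rewrite rmorph_sum mulr_sumr -sumrN /= big_seq [leRHS]big_seq.
  apply: ler_sum => j jl; rewrite QlinearB// [_ * ratr _]mulrC -mulrN.
  apply: ler_wpM2l; first by rewrite ler0q; case: (hl _ jl).
  by rewrite leNgt; apply/negP => hj; apply: hno; exists j.
have [_ []] := hl j jl.
move: kd kp hj; move: k.+1%:R^-1 => r kd kp hj hj1 hj2.
have muv1 : mu v <= 1 + d.
  rewrite -nTv -nx; have := ler_normD (T (incl R v) - x) x; rewrite subrK distrC; lra.
have muv2 : 1 - d <= mu v.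
  rewrite -nTv -nx; have := ler_normD (x - T (incl R v)) (T (incl R v)); rewrite subrK; lra.
pose z := T (incl R j.2).
have nz : `|z| <= 1 + 2 * d.
  rewrite /z nTv; lra.
have c0 : 0 < 1 + 2 * d by lra.
have fz : f x - 2 * d <= f z.
  have := fle (x - T (incl R v)); rewrite fB ler_norml => /andP[h1 h2].
  by move: hj; rewrite /h -/z; lra.
have hzx : 2 - 4 * d <= `|x - z|.
  have := ler_normD (T (incl R v) - x) (x - z); rewrite addrA subrK.
  rewrite [`|_ - x|]distrC; move: hj2; rewrite -(nTv (v - j.2)) TB -/z; lra.
have f1 : f x <= 1 by rewrite -nx; exact: le_trans (ler_norm _) (fle _).
(* Dividing by the bound on [|z|] moves [z] by at most [2 * d]. *)
exists ((1 + 2 * d)^-1 *: z); split.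
- by rewrite normrZ gtr0_norm ?invr_gt0// mulrC ler_pdivrMr// mul1r.
- rewrite -[_ *: z]addr0 fL f0 addr0 mulrC ltr_pdivlMr//.
  apply: lt_le_trans fz.
  have : (1 - alpha) * d <= d by rewrite ler_piMl ?ltW//; lra.
  by move: d1; rewrite /eta; lra.
- have : `|z - (1 + 2 * d)^-1 *: z| <= 2 * d.
    rewrite -{1}(scale1r z) -scalerBl normrZ.
    have t0 : 0 < (1 + 2 * d)^-1 by rewrite invr_gt0.
    have tE : (1 + 2 * d)^-1 * (1 + 2 * d) = 1 by rewrite mulVf ?gt_eqF.
    have -> : 1 - (1 + 2 * d)^-1 = (1 + 2 * d)^-1 * (2 * d) by lra.
    rewrite gtr0_norm ?mulr_gt0// -mulrA ler_pdivrMl// mulrC.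
    by apply: ler_wpM2r => //; rewrite mulr_ge0// ltW.
  have := ler_normD (x - (1 + 2 * d)^-1 *: z) ((1 + 2 * d)^-1 *: z - z).
  rewrite addrA subrK [`|_ *: z - z|]distrC; lra.
Qed.

(** By contraposition: outside the hull, a separating [f] drops by at least [1/(k+1)] from [x] to
    every almost diametral vector, while the DLD2P for a slice of the extension of [f] yields such a
    vector with a smaller drop. *)
Lemma DLD2P_diametral_hull mu :
  is_seminorm_V mu -> DLD2P (completion mu) ->
  forall x k, diametral_hull mu x k.
Proof.
move=> smu dld x k; apply: contrapT => nhull.
have qmu := seminorm_V_Qseminorm smu; have [muD muZ] := qmu.
set d : R := k.+1%:R^-1.
have d0 : 0 < d by rewrite invr_gt0 ltr0n.
pose G := [set w | almost_diametral mu x k (w + x)].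
have [l Gl|f [fL fmu fG]] := @seminorm_separation R {poly rat} mu G d qmu.
  rewrite leNgt; apply/negP => hlt; apply: nhull.
  exists [seq (j.1, j.2 + x) | j <- l]; split.
    by move=> _ /mapP[j /Gl [j0 Gj] ->].
  rewrite !big_map /=; apply: le_lt_trans hlt.
  by under eq_bigr do rewrite addrK.
(* The vector [- x] is itself almost diametral to [x], so [f] drops from [x] to [- x]; hence [f x],
   and with it [mu x], is positive. *)
have M0 : 0 < mu x.
  have : G (- x - x).
    split; rewrite subrK ?QseminormN// -/d; first lra.
    have -> : x - - x = 2 *: x by rewrite opprK scaler_nat mulr2n.
    by rewrite muZ normr_nat rmorph_nat; lra.
  move/fG; rewrite QlinearB// QlinearN//.
  by have := le_trans (ler_norm _) (fmu x); lra.
pose fS : dominated mu := exist _ f (conj fL fmu).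
pose F (phi : completion mu) := \val phi fS.
have Fnorm phi : `|F phi| <= `|phi| by exact: le_completion_norm.
have FL (a : R) phi psi : F (a *: phi + psi) = a * F phi + F psi by [].
have F0 : F 0 = 0 by [].
have FZ (a : R) phi : F (a *: phi) = a * F phi by [].
have FB phi psi : F (phi - psi) = F phi - F psi by [].
have Fev v : F (eval_completion mu v) = f v by [].
clearbody F.
pose B := [set F phi | phi in [set phi : completion mu | `|phi| <= 1]].
have ubB : has_ubound B.
  exists 1 => _ [phi /= h <-]; exact: le_trans (le_trans (ler_norm _) (Fnorm _)) h.
(* The norm of [F], possibly below 1; dividing by it gives the unit functional that [DLD2P] asks
   for. *)
pose c := sup B.
pose x0 := (mu x)^-1 *: eval_completion mu x.
have nx0 : `|x0| = 1.
  by rewrite normrZ norm_eval_completion// gtr0_norm ?invr_gt0// mulVf ?gt_eqF.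
have fx0 : 0 < f x.
  have : G (- x - x).
    split; rewrite subrK ?QseminormN// -/d; first lra.
    have -> : x - - x = 2 *: x by rewrite opprK scaler_nat mulr2n.
    by rewrite muZ normr_nat rmorph_nat; lra.
  by move/fG; rewrite QlinearB// QlinearN//; lra.
have Fc phi : `|phi| <= 1 -> F phi <= c.
  by move=> h; apply: ub_le_sup => //; exists phi.
have c0 : 0 < c.
  apply: lt_le_trans (Fc x0 _); last by rewrite nx0.
  by rewrite FZ Fev mulr_gt0 ?invr_gt0.
have Fcn phi : F phi <= c * `|phi|.
  have [->|phi0] := eqVneq phi 0; first by rewrite F0 normr0 mulr0.
  have np : 0 < `|phi| by rewrite normr_gt0.
  have := Fc (`|phi|^-1 *: phi).
  rewrite normrZ gtr0_norm ?invr_gt0// mulVf ?gt_eqF// => /(_ (lexx _)).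
  by rewrite FZ ler_pdivrMl// mulrC.
have udf : unit_dual_functional (fun phi => c^-1 * F phi).
  split=> [a phi psi|phi|e e0].
  - by rewrite FL mulrDr mulrCA.
  - rewrite normrM gtr0_norm ?invr_gt0// ler_pdivrMl// ler_norml Fcn.
    by have := Fcn (- phi); rewrite normrN -[- phi]addr0 -scaleN1r FL F0 addr0 mulN1r lerNl => ->.
  - have [||_ [phi /= nphi <-] hphi] := @sup_adherent R B (c * e).
    + by rewrite mulr_gt0.
    + by split => //; exists (F x0), x0 => //=; rewrite nx0.
    by exists phi; split => //; rewrite ltr_pdivlMl// mulrBr mulr1.
have gx0 : c^-1 * F x0 <= 1 by rewrite ler_pdivrMl// mulr1; apply: Fc; rewrite nx0.
(* Scaled back by [mu x] this tolerance becomes [d / 2]; approximation by a rational [v] costs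
   another [d / 4], in total less than [d]. *)
have e0 : 0 < d / (2 * mu x) by rewrite divr_gt0 ?mulr_gt0.
(* So [1 - alpha] is [c^-1 * (F x0 - d / (2 * mu x))], just below the value at [x0]. *)
pose alpha := 1 - c^-1 * F x0 + c^-1 * (d / (2 * mu x)).
have ce0 : 0 < c^-1 * (d / (2 * mu x)) by rewrite mulr_gt0 ?invr_gt0.
have [|||phi [nphi gphi dphi]] := dld _ e0 _ udf alpha _ x0 _ _ nx0.
- by rewrite /alpha; lra.
- by rewrite nx0.
- by rewrite /alpha; lra.
have {}gphi : F x0 - d / (2 * mu x) < F phi.
  rewrite -(ltr_pM2l (x := c^-1)) ?invr_gt0// mulrBr.
  by move: gphi; rewrite /alpha; lra.
have Fx0 : mu x * F x0 = f x by rewrite FZ Fev mulrA divff ?gt_eqF// mul1r.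
have hM : mu x * (d / (2 * mu x)) = d / 2 by field; rewrite gt_eqF.
have {}gphi : f x - d / 2 < mu x * F phi.
  by rewrite -hM -Fx0 -mulrBr ltr_pM2l.
have [|v hv] := eval_completion_near (mu x *: phi) (e := d / 4).
  by rewrite divr_gt0.
have Mphi : `|mu x *: phi| <= mu x.
  by rewrite normrZ gtr0_norm// ler_piMr// ltW.
have hFv : mu x * F phi - d / 4 <= f v.
  have := le_trans (ler_norm _) (le_trans (Fnorm _) hv).
  by rewrite FB FZ Fev; lra.
have : G (v - x).
  rewrite /G /= /almost_diametral subrK -/d; split.
    rewrite -(norm_eval_completion v qmu).
    have := ler_normD (eval_completion mu v - mu x *: phi) (mu x *: phi).
    by rewrite subrK distrC; lra.
  have xx0 : eval_completion mu x = mu x *: x0.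
    by rewrite scalerA divff ?gt_eqF// scale1r.
  have -> : mu (x - v) = `|mu x *: x0 - eval_completion mu v|.
    rewrite -xx0 -(norm_eval_completion _ qmu); congr `|_|.
    apply/val_inj/funext => g /=; rewrite QlinearB//; exact: (proj1 (proj2_sig g)).
  have := ler_normD (mu x *: x0 - eval_completion mu v)
    (eval_completion mu v - mu x *: phi).
  rewrite addrA subrK [`|_ - mu x *: phi|]distrC -scalerBr normrZ gtr0_norm//.
  have : mu x * (2 - d / (2 * mu x)) < mu x * `|x0 - phi| by rewrite ltr_pM2l.
  by rewrite mulrBr hM [`|phi - x0|]distrC [`|eval_completion mu v - _|]distrC; lra.
move/fG; rewrite QlinearB//; lra.
Qed.

Lemma DLD2P_iff_diametral_hull mu : is_seminorm_V mu ->
  (forall (X : completeNormedModType R) (T : {poly R} -> X), is_Xmu mu T -> DLD2P X) <->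
  (forall x k, diametral_hull mu x k).
Proof.
move=> smu; split=> [h|h X T hT]; last exact: diametral_hull_DLD2P hT h.
exact: DLD2P_diametral_hull (h _ _ (to_completion_is_Xmu smu)).
Qed.

End Diametral.

(** * The DLD2P class is G_delta *)

Section Open.
Variable R : realType.
Implicit Types (x y v : {poly rat}).

Lemma eval_continuous v : continuous (fun mu : RV R => mu v : R).
Proof. exact: (@proj_continuous _ (fun _ : {poly rat} => R^o) v). Qed.

Lemma open_almost_diametral x k y :
  open [set mu : RV R | almost_diametral (mu : _ -> R) x k y].
Proof.
have op (a b : RV R -> R) : continuous a -> continuous b ->
    open [set mu | a mu < b mu].
  move=> ca cb; rewrite (_ : [set _ | _] = (b \- a) @^-1` [set t : R | 0 < t]).
    apply: open_comp; last exact: open_gt.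
    by move=> mu _; apply: continuousB; [exact: cb|exact: ca].
  by apply/seteqP; split=> mu /=; rewrite subr_gt0.
have cc (g : R -> R) v : continuous g -> continuous (fun mu : RV R => g (mu v)).
  by move=> cg mu; apply: (@continuous_comp _ _ _ (fun mu : RV R => mu v : R) g);
    [exact: eval_continuous|exact: cg].
apply: openI.
  apply: (op (fun mu => mu y) (fun mu => mu x + k.+1%:R^-1)).
    exact: eval_continuous.
  apply: (cc (fun t => t + k.+1%:R^-1)) => t.
  by apply: cvgD; [exact: cvg_id|exact: cvg_cst].
apply: (op (fun mu => 2 * mu x - k.+1%:R^-1) (fun mu => mu (x - y))).
  apply: (cc (fun t => 2 * t - k.+1%:R^-1)) => t.
  by apply: cvgB; [exact: mulrl_continuous|exact: cvg_cst].
exact: eval_continuous.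
Qed.

Lemma open_forall_seq (S : eqType) (T : topologicalType) (l : seq S) (U : S -> set T) :
  (forall j, open (U j)) -> open [set t | forall j, j \in l -> U j t].
Proof.
move=> oU; elim: l => [|i l IH].
  rewrite (_ : [set _ | _] = setT); first exact: openT.
  by apply/seteqP; split.
rewrite (_ : [set _ | _] = U i `&` [set t | forall j, j \in l -> U j t]).
  exact: openI.
apply/seteqP; split=> t /=.
  move=> h; split; first by apply: h; rewrite mem_head.
  by move=> j jl; apply: h; rewrite inE jl orbT.
by move=> [hi hl] j; rewrite inE => /predU1P[->|/hl].
Qed.

(** For a fixed list the condition involves finitely many values of [mu]; the signs of the weights
    are independent of [mu] and go into the index set of the union. *)
Lemma open_diametral_hull x k :
  open [set mu : RV R | diametral_hull (mu : _ -> R) x k].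
Proof.
rewrite (_ : [set _ | _] = \bigcup_(l in [set l : seq (rat * {poly rat}) |
      forall j, j \in l -> 0 <= j.1])
    ([set mu : RV R | forall j, j \in l -> almost_diametral (mu : _ -> R) x k j.2] `&`
     [set mu : RV R | (mu (\sum_(j <- l) j.1 *: (j.2 - x)) : R) <
        k.+1%:R^-1 * ratr (\sum_(j <- l) j.1)])).
  apply: bigcup_open => l _; apply: openI.
    by apply: open_forall_seq => j; exact: open_almost_diametral.
  apply: (@open_comp _ _ (fun mu : RV R => mu _ : R) [set t : R | t < _]).
    by move=> mu _; exact: eval_continuous.
  exact: open_lt.
apply/seteqP; split=> mu.
  move=> [l [hl hs]]; exists l; first by move=> j /hl[].
  by split => // j /hl[].
by move=> [l hl [hl' hs]]; exists l; split => // j jl; split; [exact: hl|exact: hl'].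
Qed.

Lemma DLD2Pclass_Gdelta (I : set (RV R)) :
  I `<=` @Pset R -> Gdelta_in I (@DLD2Pclass R I).
Proof.
move=> IP.
(* The pairs [(x, k)] are enumerated by their codes; a number that codes no pair contributes the
   whole space. *)
exists (fun n => if @unpickle ({poly rat} * nat)%type n is Some xk
  then [set mu : RV R | diametral_hull (mu : _ -> R) xk.1 xk.2] else setT).
split=> [n|].
  by case: unpickle => [xk|]; [exact: open_diametral_hull|exact: openT].
apply/seteqP; split=> mu [Imu h]; split => //.
  move=> n _; case: unpickle => // -[x k] /=.
  by move: x k; apply/(DLD2P_iff_diametral_hull (IP _ Imu)).
apply/(DLD2P_iff_diametral_hull (IP _ Imu)) => x k.
by have := h (pickle (x, k)) Logic.I; rewrite pickleK.
Qed.

End Open.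

(** * Sup norms of polynomials over subsets of [0, 1] *)

Section PolySup.
Variable R : realType.
Implicit Types (p : {poly R}) (v x y : {poly rat}) (r : R).

(** Horner's scheme: on [0, 1], multiplying by the variable keeps the bound [B] and adds [B] to the
    Lipschitz constant. [L] is positive because tolerances get divided by it. *)
Lemma poly_bounded_lipschitz p : exists B L, [/\ 0 < B, 0 < L,
  forall r, 0 <= r <= 1 -> `|p.[r]| <= B &
  forall r s, 0 <= r <= 1 -> 0 <= s <= 1 ->
    `|p.[r] - p.[s]| <= L * `|r - s| ].
Proof.
elim/poly_ind: p => [|p c [B [L [B0 L0 pB pL]]]].
  by exists 1, 1; split => // [r _|r s _ _]; rewrite !horner0 ?subrr normr0 ?mul1r.
exists (B + `|c| + 1), (L + B); split.
- by have := normr_ge0 c; lra.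
- lra.
- move=> r r01; rewrite hornerMXaddC; apply: le_trans (ler_normD _ _) _.
  have : `|p.[r] * r| <= B.
    rewrite normrM; case/andP: (r01) => r0 r1; rewrite (ger0_norm r0).
    by apply: le_trans (ler_piMr _ _) (pB r r01).
  lra.
- move=> r s r01 s01; rewrite !hornerMXaddC.
  have -> : p.[r] * r + c - (p.[s] * s + c) =
            (p.[r] - p.[s]) * r + p.[s] * (r - s) by ring.
  apply: le_trans (ler_normD _ _) _; rewrite [leRHS]mulrDl; apply: lerD.
    rewrite normrM; case/andP: (r01) => r0 r1; rewrite (ger0_norm r0).
    by apply: le_trans (ler_piMr _ _) (pL r s r01 s01).
  by rewrite normrM; apply: ler_wpM2r => //; exact: pB.
Qed.

Definition supnorm (K : set R) p := sup [set `|p.[r]| | r in K].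

Section Fixed.
Variable K : set R.
Hypothesis K01 : forall r, K r -> 0 <= r <= 1.
Hypothesis K0 : K !=set0.

Lemma supnorm_has_sup p : has_sup [set `|p.[r]| | r in K].
Proof.
split; first by have [r Kr] := K0; exists `|p.[r]|, r.
have [B [_ [_ _ pB _]]] := poly_bounded_lipschitz p.
by exists B => _ [r Kr <-]; apply: pB; exact: K01.
Qed.

Lemma le_supnorm p r : K r -> `|p.[r]| <= supnorm K p.
Proof. by move=> Kr; apply: ub_le_sup; [case: (supnorm_has_sup p)|exists r]. Qed.

Lemma supnorm_le p c : (forall r, K r -> `|p.[r]| <= c) -> supnorm K p <= c.
Proof.
move=> h; apply: ge_sup; first by case: (supnorm_has_sup p).
by move=> _ [r Kr <-]; exact: h.
Qed.

Lemma supnorm_gt p c : c < supnorm K p -> exists2 r, K r & c < `|p.[r]|.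
Proof.
move=> h; apply: contrapT => hno; move: h; apply/negP; rewrite -leNgt.
apply: supnorm_le => r Kr; rewrite leNgt; apply/negP => h.
by apply: hno; exists r.
Qed.

Lemma supnorm_ge0 p : 0 <= supnorm K p.
Proof. by have [r Kr] := K0; apply: le_trans (le_supnorm p Kr). Qed.

Lemma supnormD p q : supnorm K (p + q) <= supnorm K p + supnorm K q.
Proof.
apply: supnorm_le => r Kr; rewrite hornerD; apply: le_trans (ler_normD _ _) _.
by apply: lerD; exact: le_supnorm.
Qed.

Lemma supnormZ a p : supnorm K (a *: p) = `|a| * supnorm K p.
Proof.
have le b q : supnorm K (b *: q) <= `|b| * supnorm K q.
  apply: supnorm_le => r Kr; rewrite hornerZ normrM.
  by apply: ler_wpM2l => //; exact: le_supnorm.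
apply/eqP; rewrite eq_le le /=.
have [->|a0] := eqVneq a 0; first by rewrite normr0 mul0r supnorm_ge0.
have := le a^-1 (a *: p); rewrite scalerA mulVf// scale1r normfV.
by rewrite ler_pdivlMl ?normr_gt0.
Qed.

Definition supnormV v := supnorm K (incl R v).

Lemma supnormV_ext : is_seminorm_ext supnormV (supnorm K).
Proof.
split => //; [exact: supnorm_ge0|exact: supnormD|exact: supnormZ].
Qed.

Lemma supnormV_seminorm : is_seminorm_V supnormV.
Proof.
split; first by move=> v; exact: supnorm_ge0.
split; first by move=> v w; rewrite /supnormV inclD; exact: supnormD.
by move=> a v; rewrite /supnormV inclZ supnormZ -ratr_norm.
Qed.

(** The hypothesis makes [supnorm K] a norm, so the images of the monomials in any copy of X_mu are
    linearly independent. *)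
Lemma supnormV_Bset :
  (forall p, (forall r, K r -> root p r) -> p = 0) -> @Bset R supnormV.
Proof.
move=> Kinf.
have K0p p : supnorm K p = 0 -> p = 0.
  move=> p0; apply: Kinf => r Kr; rewrite /root -normr_le0 -p0.
  exact: le_supnorm.
split.
  split; first exact: supnormV_seminorm.
  move=> X T [TL normT _] n; exists (fun i : 'I_n => T 'X^i) => c.
  have -> : \sum_(i < n) c i *: T 'X^i = T (\sum_(i < n) c i *: 'X^i).
    have T0 : T 0 = 0.
      by have := TL (-1) 0 0; rewrite !scaleN1r addr0 oppr0 addNr.
    rewrite (big_morph T (id1 := 0) (op1 := +%R))//.
      apply: eq_bigr => i _; have := TL (c i) 'X^i 0.
      by rewrite !addr0 T0 addr0.
    by move=> p q; have := TL 1 p q; rewrite !scale1r.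
  move=> h i; have := normT _ supnormV_ext (\sum_(i < n) c i *: 'X^i).
  rewrite h normr0 => /esym /K0p /(congr1 (fun p : {poly R} => p`_i)).
  rewrite coef0 coef_sum (bigD1 i)//= coefZ coefXn eqxx mulr1 big1 ?addr0//.
  by move=> j ji; rewrite coefZ coefXn eq_sym -val_eqE/= in ji *; rewrite (negbTE ji) mulr0.
move=> nu hnu p; rewrite (seminorm_ext_unique hnu supnormV_ext).
exact: K0p.
Qed.

End Fixed.

(** * Peak polynomials, isolated points and perfect sets *)

Lemma expr_small (z e : R) : 0 <= z < 1 -> 0 < e -> exists m, z ^+ m <= e.
Proof.
move=> /andP[z0 z1] e0.
have /cvgrPdist_le/(_ e e0) [m _ /(_ m (leqnn m))] := @cvg_expr R z ltac:(by rewrite ger0_norm).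
rewrite /= sub0r normrN ger0_norm ?exprn_ge0// => h; by exists m.
Qed.

Lemma one_minus_sqr_itv (g : R) : 0 < g <= 1 -> 0 <= 1 - g ^+ 2 < 1.
Proof.
move=> /andP[g0 g1]; rewrite gtrBl exprn_gt0// andbT subr_ge0 expr_le1//.
exact: ltW.
Qed.

(** For [q] in [0, 1] it is 1 at [q], has values in [0, 1] on that interval, and decays there as [m]
    grows, uniformly at a positive distance from [q]. *)
Definition peak (q : rat) m : {poly rat} := (1 - ('X - q%:P) ^+ 2) ^+ m.

Lemma peakE q m r : (incl R (peak q m)).[r] = (1 - (r - ratr q) ^+ 2) ^+ m.
Proof.
by rewrite /incl /peak rmorphXn rmorphB rmorph1 rmorphXn rmorphB /= map_polyX
  map_polyC !hornerE.
Qed.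

Lemma sqr_dist_le1 r s : 0 <= r <= 1 -> 0 <= s <= 1 -> (r - s) ^+ 2 <= 1.
Proof.
move=> /andP[r0 r1] /andP[s0 s1]; rewrite -real_normK ?num_real// expr_le1//.
by rewrite ler_norml; apply/andP; split; lra.
Qed.

Lemma peak_itv q m r : 0 <= r <= 1 -> 0 <= (ratr q : R) <= 1 ->
  0 <= (incl R (peak q m)).[r] <= 1.
Proof.
move=> r01 q01; rewrite peakE; have h := sqr_dist_le1 r01 q01.
by rewrite exprn_ge0 ?exprn_ile1 ?subr_ge0// gerBl sqr_ge0.
Qed.

Lemma peak_far q m r g e : 0 <= r <= 1 -> 0 <= (ratr q : R) <= 1 -> 0 <= g ->
  g <= `|r - ratr q| -> (1 - g ^+ 2) ^+ m <= e -> (incl R (peak q m)).[r] <= e.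
Proof.
move=> r01 q01 g0 rg; rewrite peakE; apply: le_trans.
have h := sqr_dist_le1 r01 q01.
have hg : g ^+ 2 <= (r - ratr q) ^+ 2.
  by rewrite -[leRHS]real_normK ?num_real// lerXn2r// nnegrE.
by apply: lerXn2r; rewrite ?nnegrE ?subr_ge0//; lra.
Qed.

(** Let [x] be a peak at the isolated point, at most 1/10 on the rest of [K]. An almost diametral
    [y] can be far from [x] only at [ratr q], where it lies well below [x]; averages of such [y]
    stay away from [x]. *)
Lemma isolated_not_DLD2P (K : set R) (q : rat) g :
  (forall r, K r -> 0 <= r <= 1) -> K (ratr q) -> 0 < g <= 1 ->
  (forall r, K r -> r != ratr q -> g <= `|r - ratr q|) ->
  ~ forall x k, diametral_hull (supnormV K) x k.
Proof.
move=> K01 Kq /andP[g0 g1] Kg hull.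
have K0 : K !=set0 by exists (ratr q).
have [|m hm] := @expr_small (1 - g ^+ 2) 10^-1 _ ltac:(lra).
  by apply: one_minus_sqr_itv; rewrite g0.
set x := peak q m.
have q01 := K01 _ Kq.
have xq : (incl R x).[ratr q] = 1 by rewrite peakE subrr expr0n subr0 expr1n.
have x01 r : K r -> 0 <= (incl R x).[r] <= 1.
  by move=> Kr; apply: peak_itv => //; exact: K01.
have nx : supnormV K x = 1.
  apply/eqP; rewrite eq_le; apply/andP; split.
    apply: supnorm_le => // r /x01 /andP[h1 h2]; by rewrite ger0_norm.
  by have := le_supnorm K01 K0 (incl R x) Kq; rewrite xq normr1.
(* With [k = 2], almost diametral means norm below 4/3 and distance above 5/3, and the hull must
   come within 1/3. *)
have [l [hl]] := hull x 2%N; rewrite /almost_diametral nx in hl *.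
set S := \sum_(j <- l) j.1.
have S0 : 0 <= (ratr S : R).
  by rewrite ler0q /S big_seq; apply: sumr_ge0 => j /hl[].
apply/negP; rewrite -leNgt.
apply: le_trans (_ : 5 / 3 * ratr S <= _).
  by apply: ler_wpM2r => //; lra.
apply: le_trans (le_supnorm K01 K0 _ Kq).
rewrite -normrN; apply: le_trans (ler_norm _).
rewrite lerNr.
have hy j : j \in l -> (incl R j.2).[ratr q] - 1 <= - (5 / 3).
  move=> /hl [_ [y1 y2]].
  have [r Kr] := supnorm_gt K01 K0 y2.
  have hyr s : K s -> `|(incl R j.2).[s]| <= 4 / 3.
    by move=> Ks; have := le_supnorm K01 K0 (incl R j.2) Ks; move: y1; rewrite /supnormV; lra.
  rewrite inclB hornerD hornerN.
  have [->|rq] := eqVneq r (ratr q).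
    rewrite xq; have := hyr _ Kq; rewrite ler_norml => /andP[h1 h2].
    by rewrite ltr_normr => /orP[h|h]; lra.
  (* Off [ratr q] the distance is at most [1/10 + 4/3], which is less than 5/3. *)
  have := peak_far (K01 _ Kr) q01 (ltW g0) (Kg _ Kr rq) hm; rewrite -/x => hx.
  have := hyr _ Kr; rewrite ler_norml => /andP[h1 h2].
  have /andP[h3 h4] := x01 _ Kr.
  by rewrite ltr_normr => /orP[h|h]; lra.
pose h v := (incl R v).[ratr q].
have hL : Qlinear h by move=> a v w; rewrite /h inclD inclZ hornerD hornerZ.
rewrite -[_.[_]]/(h _) Qlinear_sum// rmorph_sum mulr_sumr -sumrN /=.
rewrite big_seq [leRHS]big_seq; apply: ler_sum => j jl.
have j0 : 0 <= (ratr j.1 : R) by rewrite ler0q; case: (hl _ jl).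
rewrite [_ / _ * _]mulrC -mulrN; apply: ler_wpM2l => //.
by rewrite QlinearB// /h xq; exact: hy.
Qed.

(** Around a point where [|x|] is nearly maximal, [N] narrow peaks [h i] are placed in [K], and [x]
    is averaged from the [x * (1 - 2 h i)]. The average misses [x] by [2 x / N] times the sum of the
    peaks, which is at most 2. *)
Lemma perfect_DLD2P (K : set R) :
  (forall r, K r -> 0 <= r <= 1) -> K !=set0 ->
  (forall a, K a -> exists u w,
     [/\ u < w, u <= a <= w & forall r, u <= r <= w -> K r]) ->
  forall x k, diametral_hull (supnormV K) x k.
Proof.
move=> K01 K0 Kitv x k.
have d0 : 0 < k.+1%:R^-1 :> R by rewrite invr_gt0 ltr0n.
rewrite /diametral_hull /almost_diametral; move: k.+1%:R^-1 d0 => d d0.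
set M := supnormV K x.
have M0 : 0 <= M by exact: supnorm_ge0.
have [a Ka Pa] : exists2 a, K a & M - d / 4 < `|(incl R x).[a]|.
  by apply: supnorm_gt => //; rewrite -/(supnormV K x) -/M; lra.
have [_ [L [_ L0 _ PL]]] := poly_bounded_lipschitz (incl R x).
have [u [w [uw /andP[ua aw] uwK]]] := Kitv a Ka.
pose e := d / 4 / L.
have e0 : 0 < e by rewrite !divr_gt0.
(* A nondegenerate part of [[u, w]] near [a], on a side of [a] where there is room. *)
have [c [c' [cc' hc]]] : exists c c' : R, c < c' /\
    forall r, c <= r <= c' -> u <= r <= w /\ `|r - a| <= e.
  have [aw'|] := ltP a w.
    exists a, (Num.min w (a + e)); split; first by rewrite lt_min aw' ltrDl.
    move=> r /andP[r1]; rewrite le_min => /andP[r2 r3].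
    by rewrite (le_trans ua r1) r2 ger0_norm; lra.
  move=> wa; exists (Num.max u (a - e)), a.
  split; first by rewrite gt_max ltrBlDr ltrDl e0 (lt_le_trans uw).
  move=> r /andP[]; rewrite ge_max => /andP[r1 r2] r3.
  by rewrite r1 (le_trans r3)//= ler0_norm; lra.
have hP r : c <= r <= c' -> M - d / 2 < `|(incl R x).[r]|.
  move=> /hc [rK ra].
  have := PL r a (K01 _ (uwK _ rK)) (K01 _ Ka).
  have : L * `|r - a| <= d / 4.
    by rewrite mulrC -ler_pdivlMr.
  have := ler_normD ((incl R x).[a] - (incl R x).[r]) (incl R x).[r].
  by rewrite subrK distrC; lra.
have [q0] := rat_in_itvoo cc'; rewrite in_itv /= => /andP[cq0 q0c].
have [q1] := rat_in_itvoo q0c; rewrite in_itv /= => /andP[q01 q1c].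
pose N := (Num.trunc (4 * M / d)).+1.
have NM : 4 * M < d * N%:R.
  by rewrite [d * _]mulrC -ltr_pdivrMr//; exact: truncnS_gt.
have N0 : 0 < (N%:R : rat) by rewrite ltr0n.
pose g := (q1 - q0) / N%:R.
have g0 : 0 < g by rewrite divr_gt0// subr_gt0 -(ltr_rat R).
pose q (i : nat) : rat := q0 + g * i%:R.
have hq (i : 'I_N) : c <= ratr (q i) <= c'.
  have h1 : q0 <= q i by rewrite lerDl mulr_ge0 ?ler0n// ltW.
  have h2 : q i <= q1.
    rewrite -lerBrDl /g mulrAC ler_pdivrMr// ler_wpM2l ?ler_nat ?(ltnW (ltn_ord i))//.
    by rewrite subr_ge0 -(ler_rat R) ltW.
  move: h1 h2; rewrite -!(ler_rat R) => h1 h2; apply/andP; split; lra.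
have qK (i : 'I_N) : K (ratr (q i)) by apply: uwK; case: (hc _ (hq i)).
have gap (i j : 'I_N) : i != j -> (ratr g : R) <= `|ratr (q i) - ratr (q j)|.
  move=> ij; rewrite -rmorphB -ratr_norm ler_rat /q opprD addrACA subrr add0r.
  rewrite -mulrBr normrM gtr0_norm// ler_peMr ?(ltW g0)//.
  have [lt|lt|eq] := ltngtP i j; last by move: ij; rewrite -val_eqE /= eq eqxx.
    by rewrite distrC -natrB ?(ltnW lt)// normr_nat ler1n subn_gt0.
  by rewrite -natrB ?(ltnW lt)// normr_nat ler1n subn_gt0.
have rg0 : 0 < (ratr g : R) by rewrite ltr0q.
(* At most half the gap, so a point is closer than this to at most one [q i]; the cap at 1 is for
   [one_minus_sqr_itv]. *)
pose g2 : R := Num.min (ratr g / 2) 1.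
have g20 : 0 < g2 by rewrite lt_min divr_gt0 ?ltr01.
have g21 : g2 <= 1 by rewrite ge_min lexx orbT.
have [||m hm] := @expr_small (1 - g2 ^+ 2) N%:R^-1.
- by apply: one_minus_sqr_itv; rewrite g20.
- by rewrite invr_gt0 ltr0n.
pose h (i : 'I_N) := peak (q i) m.
have h01 i r : K r -> 0 <= (incl R (h i)).[r] <= 1.
  by move=> Kr; apply: peak_itv; exact: K01.
(* A peak that is close contributes at most 1, the others at most [1/N] each. *)
have hsum r : K r -> 0 <= \sum_(i < N) (incl R (h i)).[r] <= 2.
  move=> Kr; apply/andP; split.
    by apply: sumr_ge0 => i _; case/andP: (h01 i r Kr).
  have small (i : 'I_N) : g2 <= `|r - ratr (q i)| -> (incl R (h i)).[r] <= N%:R^-1.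
    by move=> hg; apply: peak_far hg hm; [exact: K01|exact: K01|exact: ltW].
  have NV : \sum_(i < N) (N%:R^-1 : R) = 1.
    by rewrite sumr_const card_ord -[_ *+ N]mulr_natr mulVf// pnatr_eq0.
  have [[i0 hi0]|no] := pselect (exists i : 'I_N, `|r - ratr (q i)| < g2).
    rewrite (bigD1 i0)//=; apply: lerD; first by case/andP: (h01 i0 r Kr).
    rewrite -NV [leRHS](bigD1 i0)//= -[leLHS]add0r; apply: lerD.
      by rewrite invr_ge0 ler0n.
    apply: ler_sum => i ii0; apply: small.
    have := gap _ _ ii0; have := ler_distD r (ratr (q i)) (ratr (q i0)).
    have : g2 <= ratr g / 2 by rewrite ge_min lexx.
    by rewrite [`|ratr (q i) - r|]distrC; lra.
  apply: le_trans (_ : 1 <= _); last by lra.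
  rewrite -NV; apply: ler_sum => i _; apply: small; rewrite leNgt.
  by apply/negP => hi; apply: no; exists i.
(* The factor [1 - 2 h i] lies in [-1, 1] on [K], so the norm does not grow, and it equals -1 at
   [q i], where [x - y i] is thus [2 x]. *)
pose y i := x * (1 - 2 *: h i).
have yE i r : (incl R (y i)).[r] = (incl R x).[r] * (1 - 2 * (incl R (h i)).[r]).
  rewrite /y /incl rmorphM rmorphB rmorph1 /= map_polyZ !hornerE.
  by rewrite rmorph_nat.
have xyE i r : (incl R (x - y i)).[r] = 2 * ((incl R x).[r] * (incl R (h i)).[r]).
  by rewrite inclB hornerD hornerN yE; ring.
exists [seq (1, y i) | i <- index_enum 'I_N]; split.
  move=> _ /mapP[i _ ->] /=; split => //; split.
    apply: le_lt_trans (_ : M < _); last by lra.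
    apply: supnorm_le => // r Kr; rewrite yE normrM.
    apply: le_trans (ler_piMr _ _) (le_supnorm K01 K0 _ Kr) => //.
    by have /andP[h1 h2] := h01 i r Kr; rewrite ler_norml; apply/andP; split; lra.
  apply: lt_le_trans (le_supnorm K01 K0 _ (qK i)).
  rewrite xyE /h peakE subrr expr0n subr0 expr1n mulr1 normrM normr_nat.
  by have := hP _ (hq i); lra.
rewrite !big_map /=.
have -> : \sum_(i : 'I_N) (1 : rat) = N%:R by rewrite sumr_const card_ord.
rewrite rmorph_nat; apply: le_lt_trans NM.
apply: supnorm_le => // r Kr.
have -> : (incl R (\sum_(i < N) 1 *: (y i - x))).[r] =
   - 2 * ((incl R x).[r] * \sum_(i < N) (incl R (h i)).[r]).
  rewrite /incl rmorph_sum horner_sum !mulr_sumr; apply: eq_bigr => i _.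
  by rewrite scale1r -opprB -/(incl R _) /incl rmorphN /= hornerN [X in - X]xyE mulNr.
rewrite !normrM normrN normr_nat.
have /andP[s0 s2] := hsum r Kr; rewrite (ger0_norm s0).
have := ler_pM (normr_ge0 _) s0 (le_supnorm K01 K0 (incl R x) Kr) s2.
rewrite -/(supnormV K x) -/M; lra.
Qed.

End PolySup.

(** * Reduction of an arbitrary G_delta set *)

Section Intervals.
Variable R : realType.
Implicit Types (t : nat -> R) (r s a : R).

(* The union of the [2^-n (1 - t_n / 4), 2^-n]; the others stay at
   distance at least 2^-(n+1) from 2^-n, which is thus isolated iff t_n = 0. *)
Definition intervals t : set R :=
  [set r | exists n s, 0 <= s <= 1 /\ r = 2^-1 ^+ n * (1 - s * t n / 4)].

Definition unit_valued t := forall n, 0 <= t n <= 1.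

Lemma half_expr_gt0 n : 0 < 2^-1 ^+ n :> R.
Proof. by rewrite exprn_gt0// invr_gt0. Qed.

Lemma half_expr_le m n : (m <= n)%N -> 2^-1 ^+ n <= 2^-1 ^+ m :> R.
Proof. by move=> mn; apply: ler_wiXn2l => //; lra. Qed.

Lemma prod_unit_itv (s u : R) : 0 <= s <= 1 -> 0 <= u <= 1 -> 0 <= s * u <= 1.
Proof.
by move=> /andP[s0 s1] /andP[u0 u1]; rewrite mulr_ge0// mulr_ile1.
Qed.

Lemma intervals_sub01 t : unit_valued t ->
  forall r, intervals t r -> 0 <= r <= 1.
Proof.
move=> t01 r [n [s [s01 ->]]]; have /andP[h0 h1] := prod_unit_itv s01 (t01 n).
have := half_expr_gt0 n; have := @half_expr_le 0 n isT; rewrite expr0 => k1 k0.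
apply/andP; split; first by apply: mulr_ge0; [exact: ltW|lra].
by apply: mulr_ile1; [exact: ltW|lra|exact: k1|lra].
Qed.

Lemma intervals_endpoint t n : intervals t (2^-1 ^+ n).
Proof. by exists n, 0; rewrite lexx ler01; split => //; ring. Qed.

Lemma intervals_nonempty t : intervals t !=set0.
Proof. by exists (2^-1 ^+ 0); exact: intervals_endpoint. Qed.

Lemma intervals_infinite t (p : {poly R}) :
  (forall r, intervals t r -> root p r) -> p = 0.
Proof.
move=> rp.
apply: (@roots_geq_poly_eq0 _ p [seq 2^-1 ^+ i | i <- iota 0 (size p)]).
- by apply/allP => _ /mapP[i _ ->]; apply: rp; exact: intervals_endpoint.
- rewrite map_inj_uniq ?iota_uniq//.
  apply: (@ieexprIn R 2^-1); first by rewrite invr_gt0.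
  by apply/eqP => h; lra.
- by rewrite size_map size_iota.
Qed.

Lemma intervals_perfect t : (forall n, 0 < t n) ->
  forall a, intervals t a -> exists u w,
     [/\ u < w, u <= a <= w & forall r, u <= r <= w -> intervals t r].
Proof.
move=> t0 a [n [s [/andP[s0 s1] ->]]]; have h0 := half_expr_gt0 n.
have tn0 := t0 n; set h : R := 2^-1 ^+ n in h0 *.
exists (h * (1 - t n / 4)), h; split.
- by rewrite gtr_pMr//; lra.
- rewrite ler_pM2l// ger_pMr//; apply/andP; split.
    have : s * t n <= t n by rewrite ler_piMl// ltW.
    by lra.
  have : 0 <= s * t n by rewrite mulr_ge0// ltW.
  by lra.
(* The parameter solves [r = h * (1 - s * t n / 4)] for [s]. *)
- move=> r /andP[r0 r1]; exists n, (4 * (1 - r / h) / t n); split.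
    have hr1 : r / h <= 1 by rewrite ler_pdivrMr// mul1r.
    have hr0 : 1 - t n / 4 <= r / h by rewrite ler_pdivlMr// mulrC.
    apply/andP; split; first by apply: divr_ge0 (ltW tn0); lra.
    by rewrite ler_pdivrMr// mul1r; lra.
  rewrite -/h divfK ?gt_eqF//.
  have -> : 1 - 4 * (1 - r / h) / 4 = r / h by lra.
  by rewrite mulrC divfK ?gt_eqF.
Qed.

(** For [m < n] the interval of index [m] stays above [3/4 * 2^-m], which is at least [3/2 * 2^-n];
    for [m > n] it lies below [2^-(n+1)]; for [m = n] it is a point. *)
Lemma intervals_isolated t n : unit_valued t -> t n = 0 ->
  forall r, intervals t r -> r != 2^-1 ^+ n ->
  2^-1 ^+ n.+1 <= `|r - 2^-1 ^+ n|.
Proof.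
move=> t01 tn0 r [m [s [s01 ->]]].
have /andP[k0 k1] := prod_unit_itv s01 (t01 m).
have [mn|nm|->] := ltngtP m n; last by rewrite tn0 mulr0 mul0r subr0 mulr1 eqxx.
- move=> _; apply: le_trans (ler_norm _).
  have := half_expr_le mn; rewrite !exprS.
  have := half_expr_gt0 m; move: (2^-1 ^+ m) (2^-1 ^+ n) => h k h0 hk.
  have : h * (s * t m / 4) <= h * (1 / 4) by rewrite ler_pM2l//; lra.
  by rewrite mulrBr mulr1; lra.
- move=> _; rewrite distrC; apply: le_trans (ler_norm _).
  have := half_expr_le nm; rewrite exprS.
  have := half_expr_gt0 m; move: (2^-1 ^+ m) (2^-1 ^+ n) => h k h0 hk.
  have : 0 <= h * (s * t m / 4) by apply: mulr_ge0 (ltW h0) _; lra.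
  by rewrite mulrBr mulr1; lra.
Qed.

Lemma intervals_DLD2P t : unit_valued t ->
  (forall x k, diametral_hull (supnormV (intervals t)) x k) <->
  (forall n, 0 < t n).
Proof.
move=> t01; split=> [hull n|t0]; last first.
  apply: perfect_DLD2P; [exact: intervals_sub01|exact: intervals_nonempty|].
  exact: intervals_perfect.
rewrite lt_neqAle; case/andP: (t01 n) => -> _; rewrite andbT eq_sym.
apply/eqP => tn0; move: hull.
have qn : ratr (2^-1 ^+ n) = 2^-1 ^+ n :> R.
  by rewrite rmorphXn /= fmorphV rmorph_nat.
apply: (@isolated_not_DLD2P R (intervals t) (2^-1 ^+ n) (2^-1 ^+ n.+1)).
- exact: intervals_sub01.
- by rewrite qn; exact: intervals_endpoint.
- by rewrite half_expr_gt0 -[leRHS](expr0 2^-1) half_expr_le.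
- by rewrite qn; exact: intervals_isolated.
Qed.

(** Each point of [intervals t] is matched with the point of [intervals t'] having the same [n] and
    [s], at distance at most [e]. *)
Lemma supnorm_intervals_le t t' p L e :
  unit_valued t -> unit_valued t' -> 0 < L ->
  (forall r s, 0 <= r <= 1 -> 0 <= s <= 1 ->
     `|p.[r] - p.[s]| <= L * `|r - s|) ->
  (forall n, 2^-1 ^+ n * `|t n - t' n| <= e) ->
  supnorm (intervals t) p <= supnorm (intervals t') p + L * e.
Proof.
move=> t01 t'01 L0 pL tt'.
apply: supnorm_le (intervals_sub01 t01) (intervals_nonempty t) _ _ _ => r Kr.
have r01 := intervals_sub01 t01 Kr; case: Kr => n [s [s01 rE]].
pose r' := 2^-1 ^+ n * (1 - s * t' n / 4).
have Kr' : intervals t' r' by exists n, s.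
have r'01 := intervals_sub01 t'01 Kr'.
have := le_supnorm (intervals_sub01 t'01) (intervals_nonempty t') p Kr'.
have := pL _ _ r01 r'01.
have : L * `|r - r'| <= L * e.
  rewrite ler_pM2l//; apply: le_trans (tt' n).
  have -> : r - r' = 2^-1 ^+ n * (s / 4 * (t' n - t n)) by rewrite rE /r'; ring.
  rewrite normrM (ger0_norm (ltW (half_expr_gt0 n))).
  apply: ler_wpM2l; first exact: ltW (half_expr_gt0 n).
  rewrite normrM distrC; case/andP: s01 => s0 s1.
  by rewrite ger0_norm ?divr_ge0// ler_piMl//; lra.
have := ler_normD (p.[r] - p.[r']) p.[r']; rewrite subrK; lra.
Qed.

End Intervals.

Section Reduction.
Variables (R : realType) (Z : topologicalType) (t : Z -> nat -> R).
Hypothesis t01 : forall z, unit_valued (t z).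
Hypothesis tcont : forall n, continuous (t^~ n).

Definition intervals_norm (z : Z) : RV R := supnormV (intervals (t z)).

(** The factor [2^-n] makes the coordinates [n >= N] harmless whatever their values in [0, 1];
    continuity handles the finitely many others. *)
Lemma supnorm_intervals_continuous (p : {poly R}) :
  continuous (fun z => supnorm (intervals (t z)) p : R).
Proof.
move=> z; apply/cvgrPdist_le => e e0.
have [_ [L [_ L0 _ pL]]] := poly_bounded_lipschitz p.
have eL0 : 0 < e / L by rewrite divr_gt0.
have [|N hN] := @expr_small R 2^-1 (e / L) _ eL0.
  by apply/andP; split; lra.
have tnear M : \forall z' \near z,
    forall n, (n < M)%N -> `|t z n - t z' n| <= e / L.
  elim: M => [|M IH]; first by apply: filterE.
  have /cvgrPdist_le/(_ _ eL0) tM := @tcont M z.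
  apply: filterS2 IH tM => z' h1 h2 n.
  by rewrite ltnS leq_eqVlt => /predU1P[->|/h1].
apply: filterS (tnear N) => z' hz'.
have tt n : 2^-1 ^+ n * `|t z n - t z' n| <= e / L.
  have h0 := half_expr_gt0 R n.
  have [nN|Nn] := ltnP n N.
    apply: le_trans (hz' n nN); rewrite ler_piMl//.
    by rewrite -[leRHS](expr0 2^-1) half_expr_le.
  apply: le_trans hN; apply: le_trans (half_expr_le R Nn).
  rewrite ler_piMr ?(ltW h0)// ler_norml.
  have /andP[a0 a1] := t01 z n; have /andP[b0 b1] := t01 z' n.
  by apply/andP; split; lra.
have tt' n : 2^-1 ^+ n * `|t z' n - t z n| <= e / L by rewrite distrC.
have := supnorm_intervals_le (t01 z) (t01 z') L0 pL tt.
have := supnorm_intervals_le (t01 z') (t01 z) L0 pL tt'.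
rewrite [L * _]mulrC divfK ?gt_eqF// => h1 h2.
by rewrite ler_norml; apply/andP; split; lra.
Qed.

Lemma intervals_norm_continuous : continuous intervals_norm.
Proof.
(* Convergence is checked at each [v]; constant functions show that evaluation is onto, as
   [cvg_image] demands. *)
move=> z; apply/cvg_sup => v; apply/cvg_image.
  by rewrite eqEsubset; split=> // r _; exists (cst r).
move=> W hW; exists [set mu : RV R | W (mu v)].
  exact: (@supnorm_intervals_continuous (incl R v) z W hW).
rewrite eqEsubset; split=> [_ [mu Wmu <-]//|r Wr].
by exists (cst r).
Qed.

Lemma intervals_norm_Bset z : @Bset R (intervals_norm z).
Proof.
apply: supnormV_Bset; [exact: intervals_sub01|exact: intervals_nonempty|].
exact: intervals_infinite.
Qed.

Lemma intervals_norm_DLD2Pclass (I : set (RV R)) z :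
  I (intervals_norm z) -> DLD2Pclass I (intervals_norm z) <-> forall n, 0 < t z n.
Proof.
move=> Iz; rewrite -intervals_DLD2P//.
have smu : is_seminorm_V (intervals_norm z).
  by case: (intervals_norm_Bset z) => -[].
by rewrite -(DLD2P_iff_diametral_hull smu); split=> [[]|].
Qed.

End Reduction.

(** * Truncated distance to the complement of an open set *)

Section DistanceToComplement.
Variables (R : realType) (Z : topologicalType) (d : Z -> Z -> R).
Hypothesis d0 : forall x y, 0 <= d x y.
Hypothesis dxx : forall x, d x x = 0.
Hypothesis dC : forall x y, d x y = d y x.
Hypothesis dT : forall x y z, d x z <= d x y + d y z.
Hypothesis openE : forall A : set Z, open A <->
  (forall x, A x -> exists e : R, 0 < e /\ [set y | d x y < e] `<=` A).
Variable G : set Z.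

(** The value 1 truncates the distance and keeps the set nonempty when [G] is everything. *)
Definition dist_compl z : R :=
  inf [set r | r = 1 \/ exists w, ~ G w /\ r = d z w].

Let has_lb z : has_lbound [set r | r = 1 \/ exists w, ~ G w /\ r = d z w].
Proof. by exists 0 => r [->|[w [_ ->]]]. Qed.

Lemma dist_compl_ge z c :
  c <= 1 -> (forall w, ~ G w -> c <= d z w) -> c <= dist_compl z.
Proof.
move=> c1 h; apply: lb_le_inf; first by exists 1; left.
by move=> r [->|[w [Gw ->]]] //; exact: h.
Qed.

Lemma dist_compl_le1 z : dist_compl z <= 1.
Proof. by apply: ge_inf => //; left. Qed.

Lemma dist_compl_le z w : ~ G w -> dist_compl z <= d z w.
Proof. by move=> Gw; apply: ge_inf => //; right; exists w. Qed.

Lemma dist_compl01 z : 0 <= dist_compl z <= 1.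
Proof. by rewrite dist_compl_le1 dist_compl_ge. Qed.

Lemma dist_compl_gt0 z : open G -> 0 < dist_compl z <-> G z.
Proof.
move=> /openE oG; split=> [|Gz].
  by apply: contraPP => Gz; rewrite -(dxx z) ltNge dist_compl_le.
have [e [e0 eG]] := oG z Gz.
apply: lt_le_trans (_ : Num.min e 1 <= _); first by rewrite lt_min e0 ltr01.
apply: dist_compl_ge; first by rewrite ge_min lexx orbT.
move=> w Gw; rewrite ge_min; apply/orP; left; rewrite leNgt.
by apply/negP => /eG.
Qed.

Lemma dist_compl_lipschitz z z' : dist_compl z <= dist_compl z' + d z z'.
Proof.
rewrite -lerBlDr; apply: dist_compl_ge => [|w Gw].
  by have := dist_compl_le1 z; have := d0 z z'; lra.
by have := dist_compl_le z Gw; have := dT z z' w; lra.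
Qed.

Lemma dist_compl_continuous : continuous dist_compl.
Proof.
move=> z; apply/cvgrPdist_le => e e0.
have : nbhs z [set y | d z y < e].
  apply: open_nbhs_nbhs; split; last by rewrite /= dxx.
  apply/openE => x /= zx; exists (e - d z x); split; first by rewrite subr_gt0.
  by move=> y /= xy; have := dT z x y; lra.
apply: filterS => z' /= zz'.
have := dist_compl_lipschitz z z'; have := dist_compl_lipschitz z' z.
by rewrite [d z' z]dC ler_norml => h1 h2; apply/andP; split; lra.
Qed.

End DistanceToComplement.

Theorem theorem5p11 (R : realType) (I : set (RV R)) :
  I = @Pset R \/ I = @Pinf R \/ I = @Bset R ->
  Gdelta_complete R I (@DLD2Pclass R I).
Proof.
move=> hI.
(* [Pset] is the largest and [Bset] the smallest of the three: the G_delta part works inside the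
   former, the reduction lands in the latter. *)
have IP : I `<=` @Pset R by case: hI => [->|[->|->]] // mu; [case|case=> -[]].
have BI : @Bset R `<=` I by case: hI => [->|[->|->]] // mu; [case=> -[]|case].
split; [by move=> mu []|exact: DLD2Pclass_Gdelta|].
move=> Z [_ [d [[d0 dE] dC dT openE _]]] _ C [G [oG ->]].
have dxx x : d x x = 0 by apply/dE.
pose t z n := dist_compl d (G n) z.
have t01 z : unit_valued (t z) by move=> n; exact: dist_compl01.
have tcont n : continuous (t^~ n) by exact: dist_compl_continuous.
exists (intervals_norm t); split.
- by move=> z; apply: BI; exact: intervals_norm_Bset.
- exact: intervals_norm_continuous.
apply/seteqP; split=> z.
  move=> Gz; apply/intervals_norm_DLD2Pclass => //.
    by apply: BI; exact: intervals_norm_Bset.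
  by move=> n; apply: (proj2 (dist_compl_gt0 d0 dxx openE z (oG n))); exact: Gz.
move=> /intervals_norm_DLD2Pclass h n _.
apply: (proj1 (dist_compl_gt0 d0 dxx openE z (oG n))); apply: h => //.
by apply: BI; exact: intervals_norm_Bset.
Qed.
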